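(* We have $$\lim_{n\to\infty}\frac{\varphi_n}{h_n}=\frac45,\qquad \lim_{n\to\infty}\frac{\theta_n}{p_n}=\frac45,\qquad \lim_{n\to\infty}\frac{q_n}{h_n}=\frac15,\qquad \lim_{n\to\infty}\frac{r_n}{p_n}=\frac15.$$
   Context: Let $s=\sqrt3/2$. Consider the standard triangular lattice in the plane whose vertices are the points $(a+b/2,\,bs)$ with $a,b\in\mathbb Z$ and whose edges are the unit segments joining lattice points in the directions $0^\circ,60^\circ,120^\circ$; it divides the plane into unit equilateral triangles called cells. A small tile is a single cell; a large tile is an equilateral triangle of side $2$ whose vertices are lattice points (so it is a union of $4$ cells; it may point up or down). For a region $R$ that is a finite union of cells, a tiling of $R$ is a finite set of small and large tiles, each contained in $R$, with pairwise disjoint interiors and union equal to $R$. For $n\ge1$, the region $H_n$ is the union of the trapezoid with vertices $(0,0),(n,0),(n-\tfrac12,s),(\tfrac12,s)$ and the trapezoid with vertices $(\tfrac12,s),(n-\tfrac12,s),(n,2s),(0,2s)$ ($4n-2$ cells; for $n=1$ two unit triangles meeting at a point), and $P_n$ is $H_n$ with the cell with vertices $(n-1,0),(n,0),(n-\tfrac12,s)$ removed. Define $h_n$ (resp. $p_n$) as the sum, over all tilings of $H_n$ (resp. $P_n$), of the total number of tiles in the tiling; $\varphi_n$ (resp. $\theta_n$) as the same sum counting only small tiles; and $q_n$ (resp. $r_n$) as the same sum counting only large tiles. *)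

(* Defs.v *)
From HB Require Import structures.
From mathcomp Require Import all_boot all_order all_algebra.
From mathcomp Require Import finmap.

Set Implicit Arguments.
Unset Strict Implicit.
Unset Printing Implicit Defensive.

Local Open Scope fset_scope.

(* Lattice coordinates: the lattice point (a,b) : int * int is the point
   (a + b/2, b*s) of the plane, s = sqrt 3 / 2.

   Cells.  A cell is ((a,b), up):
   - up = true  : the up-pointing unit triangle with vertices (a,b),(a+1,b),(a,b+1);
   - up = false : the down-pointing unit triangle with vertices
                  (a+1,b),(a,b+1),(a+1,b+1).
   Every cell of the triangular lattice arises exactly once this way. *)
Definition cell := ((int * int) * bool)%type.

Definition upc (a b : int) : cell := ((a, b), true).
Definition dnc (a b : int) : cell := ((a, b), false).

(* Tiles.  A tile is ((a,b), k) with k : 'I_4: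
   - k = 0 : small tile = the cell upc a b;
   - k = 1 : small tile = the cell dnc a b;
   - k = 2 : large up-pointing tile with vertices (a,b),(a+2,b),(a,b+2)
             (cells upc a b, upc (a+1) b, upc a (b+1), dnc a b);
   - k = 3 : large down-pointing tile with vertices (a+1,b),(a-1,b+2),(a+1,b+2)
             (cells dnc a b, dnc (a-1) (b+1), dnc a (b+1), upc a (b+1)).
   Every small tile and every side-2 lattice triangle arises exactly once. *)
Definition tile := ((int * int) * 'I_4)%type.

Definition tcells (t : tile) : {fset cell} :=
  let: ((a, b), k) := t in
  match val k with
  | 0%N => [fset upc a b]
  | 1%N => [fset dnc a b]
  | 2%N => [fset upc a b; upc (a + 1)%R b; upc a (b + 1)%R; dnc a b]
  | _ => [fset dnc a b; dnc (a - 1)%R (b + 1)%R; dnc a (b + 1)%R; upc a (b + 1)%R]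
  end.

Definition is_small (t : tile) : bool := (val t.2 < 2)%N.
Definition is_large (t : tile) : bool := (2 <= val t.2)%N.

(* A tiling of the region R (a finite set of cells) is a finite set S of tiles,
   each contained in R, pairwise with disjoint interiors (for unions of cells:
   no common cell), whose union is R. *)
Definition is_tiling (R : {fset cell}) (S : {fset tile}) : bool :=
  [forall t : S, tcells (val t) `<=` R] &&
  [forall t1 : S, forall t2 : S,
      (t1 != t2) ==> fdisjoint (tcells (val t1)) (tcells (val t2))] &&
  ((\bigcup_(t <- S) tcells t) == R).

(* All tiles contained in R.  Any tile contained in R contains the cell
   ((a,b), _) at its anchor (a,b), so this is a complete finite list. *)
Definition anchors (R : {fset cell}) : {fset (int * int)} :=
  [fset c.1 | c in R].
Definition kinds : {fset 'I_4} := [fset k | k in ord_enum 4].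
Definition cand (R : {fset cell}) : {fset tile} :=
  [fset t in [fset ((x, k) : tile) | x : int * int in anchors R, k : 'I_4 in kinds] | tcells t `<=` R].

Definition tsum (P : pred tile) (R : {fset cell}) : nat :=
  (\sum_(S <- fpowerset (cand R) | is_tiling R S)
      #|` [fset t in S | P t]|)%N.

(* The region H_n (for n >= 1), 4n-2 cells:
   bottom row (0 <= y <= s): up cells with base [i,i+1] on y = 0, 0 <= i <= n-1,
     and the n-1 down cells between them;
   top row (s <= y <= 2s): down cells with top edge [i,i+1] on y = 2s,
     0 <= i <= n-1 (lattice index a = i-1), and the n-1 up cells between them. *)
Definition Hreg (n : nat) : {fset cell} :=
  [fset upc i%:Z 0 | i in iota 0 n] `|` [fset dnc i%:Z 0 | i in iota 0 n.-1]
  `|` [fset upc i%:Z 1 | i in iota 0 n.-1]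
  `|` [fset dnc (i%:Z - 1)%R 1 | i in iota 0 n].

Definition Preg (n : nat) : {fset cell} := Hreg n `\` [fset upc (n.-1)%:Z 0].

Definition h_ (n : nat) : nat := tsum predT (Hreg n).
Definition phi_ (n : nat) : nat := tsum is_small (Hreg n).
Definition q_ (n : nat) : nat := tsum is_large (Hreg n).
Definition p_ (n : nat) : nat := tsum predT (Preg n).
Definition theta_ (n : nat) : nat := tsum is_small (Preg n).
Definition r_ (n : nat) : nat := tsum is_large (Preg n).

(* Main.v *)
(* A tiling is determined by its large tiles: any packing of disjoint large
   tiles extends uniquely by small ones, so a tiling of R with k large tiles has
   |R| - 4k small tiles.  A large tile of H_(m+1) is given by its orientation and
   one of m columns, and two of them overlap exactly when they share a column, or
   have the same orientation and adjacent columns.  Packings are thus words of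
   length m over {empty, up, down} without up-up and down-down factors; for
   P_(m+1) the last letter must not be up.  Let z (resp. l) be the number of
   words ending in "empty" (resp. in "up", or equally in "down").  By induction
   the number of large tiles in all words ending in "empty" is (m z - l) / 2, and
   in all words ending in "up" it is (m + 1) l / 2.  So
   2 q = m (z + 2l) + l and 2 r = m (z + l): a word has on average about m/2
   large tiles, hence about 4m - 4(m/2) = 2m small ones, in the ratio 1 : 4. *)

From HB Require Import structures.
From mathcomp Require Import all_boot all_order all_algebra finmap zify.
Require Import Defs.

Set Implicit Arguments.
Unset Strict Implicit.
Unset Printing Implicit Defensive.

Local Open Scope fset_scope.

Implicit Types (R : {fset cell}) (G S : {fset tile}) (t : tile) (c : cell).

(** * Tilings correspond to packings of large tiles *)

Notation cover G := (\bigcup_(t <- G) tcells t).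

Definition disjoint_tiles (G : {fset tile}) : Prop :=
  {in G &, forall t1 t2, t1 != t2 -> [disjoint tcells t1 & tcells t2]}.

Lemma is_tilingP R S :
  reflect [/\ {in S, forall t, tcells t `<=` R}, disjoint_tiles S & cover S = R]
          (is_tiling R S).
Proof.
apply: (iffP andP) => [[/andP[/forallP sub /forallP dis] /eqP cov]|[sub dis cov]].
  split=> // [t tS|t1 t2 t1S t2S neq]; first exact: (sub [` tS]).
  by have /forallP/(_ [` t2S])/implyP := dis [` t1S]; apply.
split; last exact/eqP.
apply/andP; split; apply/forallP => t1; first exact: sub (valP t1).
by apply/forallP => t2; apply/implyP => neq; apply: dis neq; apply: valP.
Qed.

Lemma coverP (G : {fset tile}) c :
  reflect (exists2 t, t \in G & c \in tcells t) (c \in cover G).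
Proof.
apply: (iffP (bigfcupP _ _ _ _)) => [[t /andP[tG _] ct]|[t tG ct]]; exists t => //.
by rewrite tG.
Qed.

Lemma tcells_anchor t : exists u, (t.1, u) \in tcells t.
Proof.
case: t => [[a b] k]; rewrite /tcells /=.
case: (val k) => [|[|[|_]]];
  [exists true|exists false|exists true|exists false];
  by rewrite -?fsetUA ?fset1U1 ?fset11.
Qed.

(** Every tile has a cell at its own anchor, so containment in [R] already puts the anchor in
    [anchors R]: the list [cand R] misses no tile that a tiling could use. *)
Lemma mem_cand R t : (t \in cand R) = (tcells t `<=` R).
Proof.
rewrite !inE /= andb_idl // => /fsubsetP sub.
have [u /sub tu] := tcells_anchor t.
by rewrite mem_ord_enum andbT; apply/imfsetP; exists (t.1, u).
Qed.

Definition cell_tile (c : cell) : tile := (c.1, if c.2 then ord0 else inord 1).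

Lemma tcells_cell_tile c : tcells (cell_tile c) = [fset c].
Proof. by case: c => [[a b] []] //=; rewrite inordK. Qed.

Lemma cell_tile_inj : injective cell_tile.
Proof. by move=> c d /(congr1 tcells); rewrite !tcells_cell_tile => /fset1_inj. Qed.

Lemma is_small_cell_tile c : is_small (cell_tile c).
Proof. by rewrite /is_small; case: c => [? []] //=; rewrite inordK. Qed.

Lemma is_smallE t : is_small t = ~~ is_large t.
Proof. by rewrite /is_small /is_large ltnNge. Qed.

Lemma small_cell_tile t : is_small t -> exists c, t = cell_tile c.
Proof.
case: t => [x [[|[|k]] hk]] //= _.
  by exists (x, true); rewrite /cell_tile /=; congr pair; apply: val_inj.
by exists (x, false); rewrite /cell_tile /=; congr pair; apply: val_inj; rewrite /= inordK.
Qed.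

Definition packing (R : {fset cell}) (G : {fset tile}) : Prop :=
  [/\ {in G, forall t, is_large t}, {in G, forall t, tcells t `<=` R}
    & disjoint_tiles G].

(** The only tiling whose large tiles are [G]; on packings, [fill R] is inverse to [larges]. *)
Definition fill (R : {fset cell}) (G : {fset tile}) : {fset tile} :=
  G `|` [fset cell_tile c | c in R `\` cover G].

Lemma mem_fill R G t :
  reflect (t \in G \/ exists2 c, c \in R `\` cover G & t = cell_tile c)
          (t \in fill R G).
Proof.
rewrite inE; apply: (iffP orP) => [][|h]; try by left.
  by right; case/imfsetP: h => c hc ->; exists c.
by right; apply/imfsetP.
Qed.

Lemma fill_tiling R G : packing R G -> is_tiling R (fill R G).
Proof.
case=> lG sG dG; apply/is_tilingP; split.
- move=> t /mem_fill[/sG //|[c]]; rewrite inE => /andP[_ cR] ->.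
  by rewrite tcells_cell_tile fsub1set.
- have dis1 t c : t \in G -> c \in R `\` cover G -> c \notin tcells t.
    rewrite inE => tG /andP[cG _]; apply: contra cG => ct.
    by apply/coverP; exists t.
  move=> t1 t2 /mem_fill[t1G|[c cR ->]] /mem_fill[t2G|[d dR ->]] neq.
  + exact: dG.
  + by rewrite tcells_cell_tile fdisjointX1 dis1.
  + by rewrite tcells_cell_tile fdisjoint1X dis1.
  + rewrite !tcells_cell_tile fdisjoint1X inE.
    by apply: contraNneq neq => ->.
apply/fsetP => c; apply/coverP/idP => [[t /mem_fill[/sG/fsubsetP + ct|]]|cR].
- exact.
- by case=> d /fsetDP[dR _] ->; rewrite tcells_cell_tile inE => /eqP ->.
case: (boolP (c \in cover G)) => [/coverP[t tG ct]|cG].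
  by exists t => //; apply/mem_fill; left.
exists (cell_tile c); last by rewrite tcells_cell_tile inE.
by apply/mem_fill; right; exists c => //; rewrite inE cG.
Qed.

Definition larges (S : {fset tile}) : {fset tile} := [fset t in S | is_large t].

Lemma in_larges S t : (t \in larges S) = (t \in S) && is_large t.
Proof. by rewrite !inE. Qed.

Lemma larges_fill R G : packing R G -> larges (fill R G) = G.
Proof.
case=> lG _ _; apply/fsetP => t; rewrite !inE /=.
apply/andP/idP => [[/orP[//|/imfsetP[c _ ->]]]|tG]; last by rewrite tG lG.
by move=> lc; have := is_small_cell_tile c; rewrite is_smallE lc.
Qed.

Lemma larges_tiling R S : is_tiling R S -> packing R (larges S).
Proof.
case/is_tilingP => sub dis _; split=> [t|t|t1 t2]; rewrite ?in_larges => /andP[tS lt] //.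
  exact: sub.
by case/andP=> ? _; apply: dis.
Qed.

(** A cell outside the large tiles of [S] lies in a small tile of [S], which must be its own cell
    tile. Conversely, disjointness keeps the cell of a small tile of [S] out of every large tile. *)
Lemma fill_larges R S : is_tiling R S -> fill R (larges S) = S.
Proof.
case/is_tilingP => sub dis cov; apply/fsetP => t; apply/mem_fill/idP.
  case=> [|[c]]; first by rewrite in_larges => /andP[].
  case/fsetDP; rewrite -{1}cov => /coverP[u uS cu] cL ->.
  have [lu|] := boolP (is_large u).
    by case/negP: cL; apply/coverP; exists u; rewrite // in_larges uS.
  rewrite -is_smallE => /small_cell_tile[d E].
  by move: cu uS; rewrite E tcells_cell_tile inE => /eqP ->.
move=> tS; have [lt|] := boolP (is_large t); first by left; rewrite in_larges tS.
rewrite -is_smallE => st; right; have [c E] := small_cell_tile st; exists c => //.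
have ct : c \in tcells t by rewrite E tcells_cell_tile inE.
rewrite inE; apply/andP; split; last by rewrite -cov; apply/coverP; exists t.
apply/negP => /coverP[u]; rewrite in_larges => /andP[uS lu] cu.
have neq : u != t by apply: contraTneq lu => ->; rewrite -is_smallE.
by have /fdisjointP/(_ c cu) := dis _ _ uS tS neq; rewrite ct.
Qed.

Lemma card_tcells t : is_large t -> #|` tcells t| = 4.
Proof.
case: t => [[a b] [[|[|[|[|k]]]] hk]] //= _; rewrite /tcells /= /upc /dnc;
  rewrite -!fsetUA !cardfsU1 cardfs1 !(in_fsetU, in_fset1) !xpair_eqE /=; lia.
Qed.

(** Disjoint large tiles use four cells each, and every remaining cell becomes one small tile. *)
Lemma card_fill_small R G : packing R G ->
  (#|` [fset t in fill R G | is_small t]| + 4 * #|` G| = #|` R|)%N.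
Proof.
case=> lG sG dG.
have -> : [fset t in fill R G | is_small t] = [fset cell_tile c | c in R `\` cover G].
  apply/fsetP => t; rewrite !inE /=.
  apply/andP/idP => [[/orP[/lG|//]]|tc]; first by rewrite is_smallE => ->.
  by rewrite tc orbT; case/imfsetP: tc => c _ ->; rewrite is_small_cell_tile.
have cover_sub : cover G `<=` R by apply/fsubsetP => c /coverP[t /sG/fsubsetP]; apply.
have card_cover : #|` cover G| = (4 * #|` G|)%N.
  rewrite !card_fset_sum1 big_distrr /= partition_disjoint_bigfcup //.
  rewrite big_seq [RHS]big_seq; apply: eq_bigr => t /lG lt.
  by rewrite -card_fset_sum1 card_tcells.
rewrite card_imfset /=; last exact: cell_tile_inj.
by rewrite -card_cover cardfsDS // subnK // fsubset_leq_card.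
Qed.

Lemma tsum_predT R : tsum predT R = (tsum is_small R + tsum is_large R)%N.
Proof.
rewrite /tsum -big_split /=; apply: eq_bigr => S _.
have -> : [fset t in S | predT t] = S by apply/fsetP => t; rewrite !inE andbT.
rewrite -[LHS](cardfsID (larges S)) addnC.
have -> : S `&` larges S = larges S by apply/fsetP => t; rewrite !inE andbA andbb.
congr addn; congr #|` _|; apply/fsetP => t.
by rewrite !inE is_smallE /=; case: (t \in S); rewrite ?andbT.
Qed.

(** * Sums over tilings as sums over a list of packings *)

Section Enumeration.

Variables (R : {fset cell}) (W : seq {fset tile}).
Hypotheses (uW : uniq W) (memW : forall G, G \in W <-> packing R G).

(** Change of variables along the bijection [fill R] from packings to tilings, with inverse
    [larges]. *)
Lemma sum_tilings (F : {fset tile} -> nat) :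
  (\sum_(S <- fpowerset (cand R) | is_tiling R S) F S = \sum_(G <- W) F (fill R G))%N.
Proof.
rewrite -big_filter -[RHS](big_map (fill R) xpredT F); apply/perm_big/uniq_perm.
- by rewrite filter_uniq // fset_uniq.
- rewrite map_inj_in_uniq // => G1 G2 /memW p1 /memW p2 /(congr1 larges).
  by rewrite !larges_fill.
move=> S; rewrite mem_filter fpowersetE; apply/andP/mapP => [[tS _]|[G /memW pG ->]].
  exists (larges S); first exact/memW/larges_tiling.
  by rewrite fill_larges.
split; first exact: fill_tiling.
case/is_tilingP: (fill_tiling pG) => sub _ _.
by apply/fsubsetP => t /sub; rewrite mem_cand.
Qed.

Lemma tsum_large : tsum is_large R = (\sum_(G <- W) #|` G|)%N.
Proof.
rewrite /tsum sum_tilings big_seq [RHS]big_seq; apply: eq_bigr => G /memW pG.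
by rewrite [X in #|` X|]larges_fill.
Qed.

Lemma tsum_small :
  (tsum is_small R + 4 * tsum is_large R = #|` R| * size W)%N.
Proof.
rewrite tsum_large /tsum sum_tilings big_distrr -big_split /= big_seq.
rewrite (eq_bigr (fun=> #|` R|)) => [|G /memW pG]; last exact: card_fill_small.
by rewrite -big_seq big_const_seq count_predT iter_addn_0.
Qed.

End Enumeration.

(** * Large tiles and the two regions in coordinates *)

Definition large_tile (b : bool) (x y : int) : tile :=
  ((x, y), inord (if b then 2 else 3)).

Lemma val_large_tile b x y : val (large_tile b x y).2 = if b then 2 else 3.
Proof. by rewrite /= inordK //; case: b. Qed.

Lemma large_tileP t : is_large t -> exists b x y, t = large_tile b x y.
Proof.
case: t => [[x y] k] lk; exists (val k == 2), x, y; congr pair; apply: val_inj.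
by rewrite /= inordK; case: k lk => [[|[|[|[|k]]]] hk].
Qed.

Lemma is_large_large_tile b x y : is_large (large_tile b x y).
Proof. by rewrite /is_large val_large_tile; case: b. Qed.

Lemma eq_large_tile b b' x x' y y' :
  (large_tile b x y == large_tile b' x' y') = [&& b == b', x == x' & y == y'].
Proof.
apply/eqP/and3P => [E|[/eqP -> /eqP -> /eqP ->] //].
have := congr1 (fun t : tile => val t.2) E; rewrite !val_large_tile.
by case: E => -> -> _; case: b b' => [] [].
Qed.

Lemma mem_large_tile b p q x y u : (((x, y), u) \in tcells (large_tile b p q)) =
  (if b then (x == p) && (y == q) ||
            u && ((x == p + 1) && (y == q) || (x == p) && (y == q + 1))
  else (x == p) && (y == q) && ~~ u || (x == p) && (y == q + 1)
       || ~~ u && (x == p - 1) && (y == q + 1))%R.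
Proof.
rewrite /tcells /= inordK; last by case: (b).
case: b; rewrite !(in_fsetU, in_fset1) !xpair_eqE; case: u => /=; lia.
Qed.

(* The large tiles of H_n: [b] tells whether it points up, [i] is its column. *)
Definition big_tile b (i : nat) : tile := large_tile b i 0.

Lemma eq_big_tile b d i j : (big_tile b i == big_tile d j) = (b == d) && (i == j).
Proof. by rewrite eq_large_tile andbT. Qed.

Lemma mem_big_tile b i x y u : (((x, y), u) \in tcells (big_tile b i)) =
  (if b then (x == i%:Z) && (y == 0) ||
            u && ((x == i.+1%:Z) && (y == 0) || (x == i%:Z) && (y == 1))
  else (x == i%:Z) && (y == 0) && ~~ u || (x == i%:Z) && (y == 1)
       || ~~ u && (x == i%:Z - 1) && (y == 1))%R.
Proof. by rewrite mem_large_tile; case: b => //=; lia. Qed.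

Lemma disjoint_big_tile b d i j :
  [disjoint tcells (big_tile b i) & tcells (big_tile d j)] =
  (i != j) && ~~ ((b == d) && ((i.+1 == j) || (j.+1 == i))).
Proof.
apply/fdisjointP/idP => [dis|]; last first.
  move=> H [[x y] u]; rewrite !mem_big_tile; move: H; case: b d u => [] [] []; lia.
have {}dis c : c \in tcells (big_tile b i) -> c \in tcells (big_tile d j) -> False.
  by move=> /dis/negP.
apply/andP; split.
  (* Both orientations in column [i] contain the cell [dnc i 0]. *)
  apply/eqP => ij; subst j; apply: (dis (dnc i 0)); rewrite mem_big_tile.
    by case: (b); rewrite !eqxx.
  by case: (d); rewrite !eqxx.
apply/negP => /andP[/eqP bd]; subst d => adj.
(* Neighbouring up tiles share a bottom-row up cell, at the larger column; neighbouring down tiles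
   share a top-row down cell, at the smaller column. *)
apply: (dis (if b then upc (maxn i j) 0 else dnc (minn i j) 1));
  case: b {dis}; rewrite mem_big_tile; lia.
Qed.

(** Treats the four rows of [Hreg] uniformly; the offset [d] accommodates the top row of down cells,
    whose lattice indices start at [-1]. *)
Lemma mem_row (f : nat -> cell) d y0 u0 k x y u :
    (forall i, f i = ((i%:Z - d, y0), u0))%R ->
  (((x, y), u) \in [fset f i | i in iota 0 k]) =
  [&& y == y0, u == u0, (0 <= x + d)%R & (x + d < k%:Z)%R].
Proof.
move=> fE; apply/imfsetP/and4P => [[i /=]|[/eqP -> /eqP -> x0 xk]].
  by rewrite mem_iota fE => ik [-> -> ->]; split; rewrite ?eqxx //; lia.
exists `|(x + d)%R|%N; first by rewrite /= mem_iota; lia.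
by rewrite fE; congr (_, _, _); lia.
Qed.

Lemma mem_Hreg m x y u : (((x, y), u) \in Hreg m.+1) =
  ((y == 0) && (0 <= x) && (x < m%:Z + u%:Z) || (y == 1) && (u%:Z - 1 <= x) && (x < m%:Z))%R.
Proof.
rewrite !in_fsetU (@mem_row (fun i => upc i%:Z 0) 0 0 true)
  ?(@mem_row (fun i => dnc i%:Z 0) 0 0 false) ?(@mem_row (fun i => upc i%:Z 1) 0 1 true)
  ?(@mem_row (fun i => dnc (i%:Z - 1)%R 1) 1 1 false) /=;
  try by move=> i; rewrite ?GRing.subr0.
by case: u => /=; lia.
Qed.

Lemma large_sub_Hreg m t : is_large t ->
  (tcells t `<=` Hreg m.+1 <-> exists b i, i < m /\ t = big_tile b i).
Proof.
case/large_tileP => b [p [q ->]].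
split=> [/fsubsetP sub|[b' [i [im ->]]]]; last first.
  apply/fsubsetP => [[[x y] u]]; rewrite mem_big_tile mem_Hreg.
  by case: b' u => [] []; lia.
have mem_sub x y u : ((x, y), u) \in tcells (large_tile b p q) -> _ := sub ((x, y), u).
exists b, `|p|%N; suff [-> [p0 pm]] : q = 0%R /\ (0 <= p)%R /\ (p < m%:Z)%R.
  by split; [lia|rewrite /big_tile gez0_abs].
(* The tile has cells in rows [q] and [q + 1], while the region has only rows [0] and [1], so
   [q = 0]; the same cells then confine [p] to the [m] columns. *)
have := mem_sub p (q + 1)%R true.
have := mem_sub p q false.
have := mem_sub p (q + 1)%R false.
have := mem_sub (p - 1)%R (q + 1)%R false.
have := mem_sub (p + 1)%R q true.
rewrite !mem_large_tile !mem_Hreg; case: b {sub mem_sub}; lia.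
Qed.

(** The removed cell [upc m 0] is the right corner of the up tile in the last column, and no other
    large tile of the region contains it. *)
Lemma big_tile_sub_Preg m b i : i < m ->
  (tcells (big_tile b i) `<=` Preg m.+1) = ~~ (b && (i.+1 == m)).
Proof.
move=> im; rewrite fsubsetD fdisjointX1 mem_big_tile.
have -> : tcells (big_tile b i) `<=` Hreg m.+1.
  by apply/large_sub_Hreg; [exact: is_large_large_tile|exists b, i].
by case: b => /=; lia.
Qed.

Lemma card_row (f : nat -> cell) k : injective f -> #|` [fset f i | i in iota 0 k]| = k.
Proof. by move=> inj; rewrite card_imfset //= undup_id ?iota_uniq // size_iota. Qed.

Lemma card_disjointU (K : choiceType) (A B : {fset K}) :
  [disjoint A & B] -> #|` A `|` B| = (#|` A| + #|` B|)%N.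
Proof. by move/disjoint_fsetI0 => AB0; rewrite cardfsU AB0 cardfs0 subn0. Qed.

Lemma card_Hreg m : #|` Hreg m.+1| = (4 * m + 2)%N.
Proof.
rewrite /Hreg !card_disjointU.
- by rewrite !card_row /=; [lia|move=> i j []; lia..].
all: apply/fdisjointP => [[[x y] u]]; rewrite ?in_fsetU
  (@mem_row (fun i => upc i%:Z 0) 0 0 true)
  ?(@mem_row (fun i => dnc i%:Z 0) 0 0 false) ?(@mem_row (fun i => upc i%:Z 1) 0 1 true)
  ?(@mem_row (fun i => dnc (i%:Z - 1)%R 1) 1 1 false) /=;
  try by move=> i; rewrite ?GRing.subr0.
all: case: u => /=; lia.
Qed.

Lemma card_Preg m : #|` Preg m.+1| = (4 * m + 1)%N.
Proof.
rewrite cardfsDS ?card_Hreg ?cardfs1 /=; first lia.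
by rewrite fsub1set mem_Hreg; lia.
Qed.

(** * Packings as words, and their recursive enumeration *)

(* Words of length m, encoded as sets of large tiles in the columns [i < m]. *)
Definition packs m G : Prop :=
  {in G, forall t, exists b i, i < m /\ t = big_tile b i} /\ disjoint_tiles G.

Definition ends b m G : bool := (0 < m)%N && (big_tile b m.-1 \in G).

Lemma packing_Hreg m G : packing (Hreg m.+1) G <-> packs m G.
Proof.
split=> [[lG sG dG]|[mG dG]]; split=> // t tG.
- by apply/large_sub_Hreg; [exact: lG|exact: sG].
- by have [b [i [_ ->]]] := mG t tG; apply: is_large_large_tile.
- apply/large_sub_Hreg; last exact: mG.
  by have [b [i [_ ->]]] := mG t tG; apply: is_large_large_tile.
Qed.

Lemma packing_Preg m G : packing (Preg m.+1) G <-> packs m G /\ ~~ ends true m G.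
Proof.
split=> [[lG sG dG]|[[mG dG] eG]].
  have mG : {in G, forall t, exists b i, i < m /\ t = big_tile b i}.
    move=> t tG; apply/large_sub_Hreg; first exact: lG.
    by apply: fsubset_trans (sG t tG) _; apply: fsubsetDl.
  split=> //; apply/negP => /andP[m0 tG].
  have := sG _ tG; rewrite big_tile_sub_Preg ?prednK ?eqxx //=.
split=> // t tG; have [b [i [im E]]] := mG t tG; rewrite E ?is_large_large_tile //.
rewrite big_tile_sub_Preg //; apply/negP => /andP[bt /eqP mi].
by case/negP: eG; rewrite /ends -mi -[true]bt -E.
Qed.

Lemma packs_last m G b : packs m G -> big_tile b m \notin G.
Proof.
case=> mG _; apply/negP => /mG[d [i [im /eqP]]].
by rewrite eq_big_tile => /andP[_ /eqP mi]; rewrite mi ltnn in im.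
Qed.

Lemma packs_widen m G :
  packs m.+1 G -> (forall b, big_tile b m \notin G) -> packs m G.
Proof.
case=> mG dG last; split=> // t tG; have [b [i [im E]]] := mG t tG.
exists b, i; split=> //; have : i != m; last by lia.
by apply: contraNneq (last b) => <-; rewrite -E.
Qed.

Lemma packsW m G : packs m G -> packs m.+1 G.
Proof.
case=> mG dG; split=> // t /mG[b [i [im ->]]]; exists b, i; split=> //; lia.
Qed.

(** A tile in the new column [m] can only clash with a tile of the same orientation in column
    [m.-1], which [ends] excludes. *)
Lemma packs_add m b G :
  packs m G -> ~~ ends b m G -> packs m.+1 (big_tile b m |` G).
Proof.
case=> mG dG eG.
have dis t : t \in G -> [disjoint tcells (big_tile b m) & tcells t].
  move=> tG; have [d [i [im E]]] := mG t tG; rewrite E disjoint_big_tile.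
  have : ~~ ((b == d) && (i.+1 == m)); last by lia.
  apply: contra eG => /andP[/eqP -> /eqP <-].
  by rewrite /ends -E.
split=> [t|t t'].
  case/fset1UP => [->|/mG[d [i [im ->]]]]; first by exists b, m.
  by exists d, i; split=> //; lia.
move=> /fset1UP[->|tG] /fset1UP[->|t'G] neq; first by case/eqP: neq.
- exact: dis.
- by rewrite fdisjoint_sym; apply: dis.
- exact: dG.
Qed.

(** Converse of [packs_add]: deleting the last letter leaves a word to which that letter may be
    appended. *)
Lemma packs_remove m b G : packs m.+1 G -> big_tile b m \in G ->
  packs m (G `\ big_tile b m) /\ ~~ ends b m (G `\ big_tile b m).
Proof.
case=> mG dG bG.
have neg d i : big_tile d i \in G -> (d, i) <> (b, m) ->
    (i != m) && ~~ ((d == b) && ((i.+1 == m) || (m.+1 == i))).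
  move=> dGi neq; rewrite -disjoint_big_tile; apply: dG => //.
  by rewrite eq_big_tile; apply/negP => /andP[/eqP E /eqP F]; apply: neq; rewrite E F.
split; last first.
  apply/negP => /andP[m0]; rewrite !inE => /andP[_ /neg H].
  have /H : (b, m.-1) <> (b, m) by case; lia.
  by rewrite eqxx; lia.
split=> [t|t t']; last by rewrite !inE => /andP[_ ?] /andP[_ ?]; apply: dG.
rewrite !inE => /andP[neq tG]; have [d [i [im E]]] := mG t tG.
exists d, i; split=> //; have : i != m; last by lia.
rewrite E in tG neq; have /(neg _ _ tG)/andP[] // : (d, i) <> (b, m).
by case=> E1 E2; rewrite E1 E2 eqxx in neq.
Qed.

(* Words of length m ending in "empty", resp. in the letter [b]; the empty word
   counts as ending in "empty". *)
Fixpoint free_packs m : seq {fset tile} :=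
  if m is m'.+1 then free_packs m' ++ ended_packs true m' ++ ended_packs false m'
  else [:: fset0]
with ended_packs b m : seq {fset tile} :=
  if m is m'.+1 then
    [seq big_tile b m' |` G | G <- free_packs m' ++ ended_packs (~~ b) m']
  else [::].

Lemma ends_excl b m G : packs m G -> ends b m G -> ~~ ends (~~ b) m G.
Proof.
case=> _ dG /andP[m0 bG]; apply/negP => /andP[_ bG'].
have := dG _ _ bG bG'; rewrite disjoint_big_tile eq_big_tile !eqxx andbT.
by case: b {bG bG'} => /(_ isT).
Qed.

Section MemStep.

Variable m : nat.
Hypothesis mem_free : forall G, G \in free_packs m <-> packs m G /\ (forall b, ~~ ends b m G).
Hypothesis mem_ended : forall b G, G \in ended_packs b m <-> packs m G /\ ends b m G.

(** Any word may be followed by the empty letter, and every word is empty-ended, up-ended or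
    down-ended. *)
Lemma mem_free_packsS_step G : G \in free_packs m.+1 <-> packs m G.
Proof.
rewrite [free_packs _]/= !mem_cat.
split=> [/or3P[/mem_free[]|/mem_ended[]|/mem_ended[]] //|pG].
apply/or3P; have [e|e] := boolP (ends true m G); first by apply: Or32; apply/mem_ended.
have [e'|e'] := boolP (ends false m G); first by apply: Or33; apply/mem_ended.
by apply: Or31; apply/mem_free; split=> // [[]].
Qed.

(** These are the words to which the letter [b] may be appended. For [b = true] they are also the
    packings of the region with a removed cell. *)
Lemma mem_not_ended_step b G :
  G \in free_packs m ++ ended_packs (~~ b) m <-> packs m G /\ ~~ ends b m G.
Proof.
rewrite mem_cat; split=> [/orP[/mem_free[]|/mem_ended[pG eG]]|[pG eG]] //.
  by split=> //; rewrite -[b]negbK; apply: ends_excl.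
apply/orP; have [eG'|eG'] := boolP (ends (~~ b) m G); [right|left].
  exact/mem_ended.
by apply/mem_free; split=> // d; case: b d eG eG' => [] [].
Qed.

End MemStep.

(** Simultaneous induction on the last letter: an empty one is handled by [packsW] and
    [packs_widen], a tile by [packs_add] and [packs_remove]. *)
Lemma mem_free_ended m :
  (forall G, G \in free_packs m <-> packs m G /\ (forall b, ~~ ends b m G)) /\
  (forall b G, G \in ended_packs b m <-> packs m G /\ ends b m G).
Proof.
elim: m => [|m [mem_free mem_ended]].
  split=> [G|b G]; last by split=> // [[_]].
  rewrite inE; split=> [/eqP ->|[[mG _] _]].
    by split=> //; split=> t; rewrite ?inE // => t'; rewrite !inE.
  by apply/eqP/fsetP => t; rewrite inE; apply/negP => /mG[b [i []]].
split=> [G|b G].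
  rewrite mem_free_packsS_step //; split=> [pG|[pG eG]]; last exact: packs_widen.
  by split=> [|b]; [exact: packsW|exact: packs_last].
split=> [/mapP[G' /(mem_not_ended_step mem_free mem_ended)[pG' eG'] ->]|[pG bG]].
  by split; [exact: packs_add|exact: fset1U1].
have [pG' eG'] := packs_remove pG bG.
apply/mapP; exists (G `\ big_tile b m); last by rewrite fsetD1K.
exact/(mem_not_ended_step mem_free mem_ended).
Qed.

Lemma mem_free_packs m G : G \in free_packs m <-> packs m G /\ (forall b, ~~ ends b m G).
Proof. by have [] := mem_free_ended m. Qed.

Lemma mem_ended_packs b m G : G \in ended_packs b m <-> packs m G /\ ends b m G.
Proof. by have [] := mem_free_ended m. Qed.

Lemma mem_free_packsS m G : G \in free_packs m.+1 <-> packs m G.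
Proof. by have [mem_free mem_ended] := mem_free_ended m; apply: mem_free_packsS_step. Qed.

Lemma mem_not_ended b m G :
  G \in free_packs m ++ ended_packs (~~ b) m <-> packs m G /\ ~~ ends b m G.
Proof. by have [mem_free mem_ended] := mem_free_ended m; apply: mem_not_ended_step. Qed.

(** Different last letters give different words, and appending a tile in column [m] is injective
    because column [m] was free before. *)
Lemma uniq_free_ended m : uniq (free_packs m) /\ (forall b, uniq (ended_packs b m)).
Proof.
have disj_zl b k : ~~ has (in_mem^~ (mem (free_packs k))) (ended_packs b k).
  apply/hasPn => G /mem_ended_packs[_ eG].
  by apply/negP => /mem_free_packs[_ /(_ b)]; rewrite eG.
elim: m => [|m [uz ul]] //; split=> [|b] /=.
  rewrite !cat_uniq uz !ul has_cat !negb_or !disj_zl !andbT /=.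
  apply/hasPn => G /mem_ended_packs[pG eG]; apply/negP => /mem_ended_packs[_].
  exact/negP/(ends_excl pG eG).
rewrite map_inj_in_uniq => [|G1 G2 /mem_not_ended[p1 _] /mem_not_ended[p2 _] E].
  by rewrite cat_uniq uz ul disj_zl.
by rewrite -(fsetU1K (packs_last b p1)) E fsetU1K // packs_last.
Qed.

Lemma size_ended_packs b m : size (ended_packs b m) = size (ended_packs true m).
Proof.
elim: m b => [//|m IH] b; rewrite /= !size_map !size_cat.
by rewrite (IH (~~ b)) (IH false).
Qed.

(** * Counting large tiles over all words *)

Notation card_sum W := (\sum_(G <- W) #|` G|)%N.

Lemma card_sum_ended_packsS b m :
  card_sum (ended_packs b m.+1) =
  (card_sum (free_packs m) + card_sum (ended_packs (~~ b) m)
    + size (free_packs m) + size (ended_packs true m))%N.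
Proof.
rewrite /= big_map -(size_ended_packs (~~ b)) -addnA -size_cat.
rewrite -big_cat /= -sum1_size -big_split /=.
rewrite big_seq [RHS]big_seq; apply: eq_bigr => G /mem_not_ended[pG _].
by rewrite cardfsU1 packs_last // addnC.
Qed.

Lemma card_sum_free_packsS m :
  card_sum (free_packs m.+1) =
  (card_sum (free_packs m) + card_sum (ended_packs true m)
    + card_sum (ended_packs false m))%N.
Proof. by rewrite /= !big_cat /= addnA. Qed.

Lemma card_sum_free_ended m :
  (2 * card_sum (free_packs m) + size (ended_packs true m) = m * size (free_packs m))%N /\
  (forall b, 2 * card_sum (ended_packs b m) = m.+1 * size (ended_packs true m))%N.
Proof.
elim: m => [|m [IHz IHl]]; first by rewrite /= big_seq1 cardfs0; split=> // b; rewrite big_nil.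
have sz : size (free_packs m.+1) = (size (free_packs m) + 2 * size (ended_packs true m))%N.
  by rewrite /= !size_cat (size_ended_packs false); lia.
have sl : size (ended_packs true m.+1) = (size (free_packs m) + size (ended_packs true m))%N.
  by rewrite /= size_map size_cat size_ended_packs.
rewrite card_sum_free_packsS sz sl; have lt := IHl true; have lf := IHl false.
split=> [|b].
  (* With [z] and [l] the two sizes at [m], twice the new sum plus the new [l] is [(m z - l) + 2 (m
     + 1) l + (z + l) = (m + 1) (z + 2 l)]. *)
  by nia.
(* Here twice the new sum is [(m z - l) + (m + 1) l + 2 z + 2 l = (m + 2) (z + l)]. *)
by rewrite card_sum_ended_packsS; have := IHl (~~ b); nia.
Qed.

(** * Formulas for the six sums in terms of [z] and [l] *)

Section Counts.

Variable m : nat.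
Let z := size (free_packs m).
Let l := size (ended_packs true m).

Lemma double_q : (2 * q_ m.+1 = m * (z + 2 * l) + l)%N.
Proof.
(* All words of length [m] are listed by [free_packs m.+1], since appending an empty letter adds no
   tile. *)
rewrite /q_ (tsum_large (proj1 (uniq_free_ended m.+1))) => [|G]; last first.
  by rewrite mem_free_packsS packing_Hreg.
rewrite card_sum_free_packsS; have [Ez El] := card_sum_free_ended m.
have lt := El true; have lf := El false; rewrite /z /l; nia.
Qed.

Lemma phi_eq : (phi_ m.+1 + 4 * q_ m.+1 = (4 * m + 2) * (z + 2 * l))%N.
Proof.
rewrite /q_ /phi_ (tsum_small (proj1 (uniq_free_ended m.+1))) => [|G]; last first.
  by rewrite mem_free_packsS packing_Hreg.
by rewrite card_Hreg /= !size_cat (size_ended_packs false) /z /l; congr muln; lia.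
Qed.

Lemma h_eq : (h_ m.+1 = phi_ m.+1 + q_ m.+1)%N.
Proof. exact: tsum_predT. Qed.

Let uniq_Preg : uniq (free_packs m ++ ended_packs false m).
Proof.
(* Appending an up tile to these words gives the duplicate-free list [ended_packs true m.+1], so the
   words themselves are distinct. *)
by have := proj2 (uniq_free_ended m.+1) true; rewrite /= => /map_uniq.
Qed.

Let mem_Preg G : G \in free_packs m ++ ended_packs false m <-> packing (Preg m.+1) G.
Proof. by rewrite (mem_not_ended true) packing_Preg. Qed.

Lemma double_r : (2 * r_ m.+1 = m * (z + l))%N.
Proof.
rewrite /r_ (tsum_large uniq_Preg mem_Preg).
have -> : card_sum (free_packs m ++ ended_packs false m) =
    (card_sum (free_packs m) + card_sum (ended_packs false m))%N.
  exact: big_cat.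
have [Ez /(_ false) El] := card_sum_free_ended m; rewrite /z /l; nia.
Qed.

Lemma theta_eq : (theta_ m.+1 + 4 * r_ m.+1 = (4 * m + 1) * (z + l))%N.
Proof.
rewrite /r_ /theta_ (tsum_small uniq_Preg mem_Preg) card_Preg size_cat.
by rewrite (size_ended_packs false).
Qed.

Lemma p_eq : (p_ m.+1 = theta_ m.+1 + r_ m.+1)%N.
Proof. exact: tsum_predT. Qed.

End Counts.

Lemma size_free_packs_gt0 m : 0 < size (free_packs m).
Proof. by elim: m => // m IH; rewrite /= size_cat; lia. Qed.

(* Passage to the limit *)
From Stdlib Require Import Reals Lra.

Local Close Scope fset_scope.

(** The hypotheses bound [y a - x b] by [C N] in absolute value and [b] from below by [m N], so
    [a / b] differs from [x / y] by at most [C / (y m)]. The shift to [m.+1] skips the term of index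
    [0]. *)
Lemma Un_cv_ratio (a b N : nat -> nat) (x y C : nat) :
    0 < y -> (forall m, 0 < N m) -> (forall m, m * N m <= b m.+1) ->
    (forall m, y * a m.+1 <= x * b m.+1 + C * N m) ->
    (forall m, x * b m.+1 <= y * a m.+1 + C * N m) ->
  Un_cv (fun n => INR (a n) / INR (b n))%R (INR x / INR y)%R.
Proof.
move=> y0 N0 bN ub lb eps eps0.
have C0 : (0 < INR C.+1)%R by apply: lt_0_INR; lia.
(* The threshold [M] is chosen with [C + 1 < eps * M]; using [C + 1] rather than [C] avoids dividing
   by zero when [C = 0]. *)
have [M [Meps M0]] := archimed_cor1 _ (Rdiv_lt_0_compat _ _ eps0 C0).
have {}M0 : (0 < INR M)%R by apply: lt_0_INR.
exists M.+1 => -[|m] nM; first lia.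
have mM : (INR M <= INR m)%R by apply: le_INR; exact: le_S_n.
have {}ub := le_INR _ _ (leP (ub m)); have {}lb := le_INR _ _ (leP (lb m)).
have {}bN := le_INR _ _ (leP (bN m)); have {}N0 := lt_0_INR _ (ltP (N0 m)).
have y1 : (1 <= INR y)%R by apply: (le_INR 1); lia.
move: ub lb bN; rewrite -multE -plusE !plus_INR !mult_INR.
move: (N m) (a m.+1) (b m.+1) N0 => n {}a {}b n0 ub lb bN.
have CM : (INR C + 1 < eps * INR M)%R.
  rewrite -S_INR; apply: (Rmult_lt_reg_r (/ INR M)); first exact: Rinv_0_lt_compat.
  rewrite Rmult_assoc Rinv_r ?Rmult_1_r; last lra.
  rewrite Rmult_comm; apply: (Rmult_lt_reg_r (/ INR C.+1)); first exact: Rinv_0_lt_compat.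
  by rewrite Rmult_assoc Rinv_r ?Rmult_1_r; [exact: Meps|lra].
(* Chain: [C n < (C + 1) n < eps M n <= eps m n <= eps b]. *)
have Cb : (INR C * INR n < eps * INR b)%R.
  have : (eps * (INR m * INR n) <= eps * INR b)%R by apply: Rmult_le_compat_l; lra.
  have : (eps * INR M * INR n <= eps * INR m * INR n)%R.
    by apply: Rmult_le_compat_r; [lra|apply: Rmult_le_compat_l; lra].
  have : ((INR C + 1) * INR n < eps * INR M * INR n)%R by apply: Rmult_lt_compat_r.
  lra.
have b0 : (0 < INR b)%R.
  have := Rmult_le_pos _ _ (pos_INR C) (Rlt_le _ _ n0); nra.
have yb : (eps * INR b <= eps * (INR y * INR b))%R by apply: Rmult_le_compat_l; nra.
(* Isolates the error term, whose numerator is at most [C n] in absolute value, hence less than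
   [eps * y * b]. *)
have -> : (INR a / INR b = INR x / INR y + (INR y * INR a - INR x * INR b) / (INR y * INR b))%R.
  by field; lra.
have yb0 : (0 < INR y * INR b)%R by apply: Rmult_lt_0_compat; lra.
rewrite /Rdist Rplus_comm /Rminus Rplus_assoc Rplus_opp_r Rplus_0_r.
apply: Rabs_def1; apply: (Rmult_lt_reg_r (INR y * INR b)) => //;
  rewrite /Rdiv Rmult_assoc Rinv_l; lra.
Qed.

Theorem theorem7 :
  Un_cv (fun n => (INR (phi_ n) / INR (h_ n))%R) (4 / 5)%R /\
  Un_cv (fun n => (INR (theta_ n) / INR (p_ n))%R) (4 / 5)%R /\
  Un_cv (fun n => (INR (q_ n) / INR (h_ n))%R) (1 / 5)%R /\
  Un_cv (fun n => (INR (r_ n) / INR (p_ n))%R) (1 / 5)%R.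
Proof.
have -> : (4 / 5 = INR 4 / INR 5)%R by rewrite /=; field.
have -> : (1 / 5 = INR 1 / INR 5)%R by rewrite /=; field.
(* [H m] and [P m] are the numbers of tilings of [Hreg m.+1] and [Preg m.+1], and serve as [N]. *)
pose H m := size (free_packs m) + 2 * size (ended_packs true m).
pose P m := size (free_packs m) + size (ended_packs true m).
have HP m : 0 < H m /\ 0 < P m by rewrite /H /P; have := size_free_packs_gt0 m; lia.
split; [|split; [|split]].
(* Both errors equal [phi_ - 4 q_] up to sign, which is [2 * size (free_packs m)], at most
   [2 * H m]; the constant [4] leaves room. *)
1,3: apply: (@Un_cv_ratio _ _ H _ _ 4) => // m;
  [by case: (HP m)|have := double_q m; have := phi_eq m; rewrite h_eq /H; nia..].
(* Here the error [theta_ - 4 r_] is exactly [P m]. *)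
all: apply: (@Un_cv_ratio _ _ P _ _ 4) => // m;
  [by case: (HP m)|have := double_r m; have := theta_eq m; rewrite p_eq /P; nia..].
Qed.
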